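(* Let $k\ge 4$ and $n$ be integers with $n\ge c k^2$, where $c=30$ if $k\in\{4,5\}$ and $c=4$ if $k\ge 6$. If $\mathcal{F}\subseteq \binom{[n]}{k}$ is a non-trivial intersecting family, then $$\delta(\mathcal{F})\le \delta(\mathcal{HM}_{n,k}) = \binom{n-2}{k-2}-\binom{n-k-2}{k-2}.$$
   Context: $[n]=\{1,2,\dots,n\}$, and $\binom{[n]}{k}$ denotes the family of all $k$-element subsets of $[n]$. A family $\mathcal{F}$ of sets is intersecting if $A\cap B\ne\emptyset$ for all $A,B\in\mathcal{F}$. A full star is a family consisting of all the $k$-subsets of $[n]$ that contain a fixed element. An intersecting family is trivial if it is a subfamily of a full star (i.e. all its members share a common element), and non-trivial otherwise. For $x\in[n]$, the degree of $x$ in $\mathcal{F}\subseteq\binom{[n]}{k}$ is $d_{\mathcal{F}}(x)=|\{F\in\mathcal{F}: x\in F\}|$, and $\delta(\mathcal{F})=\min_{x\in[n]} d_{\mathcal{F}}(x)$ is the minimum degree. The family $\mathcal{HM}_{n,k}$ (defined up to relabelling of $[n]$) consists of a $k$-set $S\subseteq[n]$ together with all $k$-subsets of $[n]$ that contain a fixed element $x\in[n]\setminus S$ and at least one element of $S$. *)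

(* Defs.v *)
From mathcomp Require Import all_boot.

Set Implicit Arguments.
Unset Strict Implicit.
Unset Printing Implicit Defensive.

(* [n] is modelled by 'I_n, so x + 1 in [n] corresponds to x : 'I_n. *)

Definition ksubsets (n k : nat) : {set {set 'I_n}} :=
  [set A : {set 'I_n} | #|A| == k].

(* A and B may coincide. *)
Definition intersecting (n : nat) (F : {set {set 'I_n}}) : Prop :=
  forall A B : {set 'I_n}, A \in F -> B \in F -> A :&: B != set0.

Definition full_star (n k : nat) (x : 'I_n) : {set {set 'I_n}} :=
  [set A in ksubsets n k | x \in A].

Definition trivial_family (n k : nat) (F : {set {set 'I_n}}) : Prop :=
  exists x : 'I_n, F \subset full_star k x.

Definition degree (n : nat) (F : {set {set 'I_n}}) (x : 'I_n) : nat :=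
  #|[set A in F | x \in A]|.

(* Every degree is at most #|F|, so for 0 < n the default value #|F| does not
   affect the minimum. *)
Definition min_degree (n : nat) (F : {set {set 'I_n}}) : nat :=
  \big[minn/#|F|]_(x : 'I_n) degree F x.

(* HM_{n,k} is this family for any S and x with #|S| = k and x \notin S; the
   choice of (S, x) is the relabelling of [n]. *)
Definition HM (n k : nat) (S : {set 'I_n}) (x : 'I_n) : {set {set 'I_n}} :=
  S |: [set A in ksubsets n k | (x \in A) && (A :&: S != set0)].

(* Main.v *)
Require Import Defs.
From mathcomp Require Import all_boot perm zify.

Set Implicit Arguments.
Unset Strict Implicit.
Unset Printing Implicit Defensive.

(** Write d for C(n-2, k-2) - C(n-k-2, k-2), the degree in HM_{n,k} of every
point outside S and x, and suppose that every degree in F is larger than d.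
The two halves of the proof bound the sizes of the families
F(~x) = {A in F : x notin A} from below and from above, and the bounds clash.

From below ([diversity_lower_bound]): F(~x) is nonempty, so take S, U in F(~x)
with |S \ U| maximal, and add up the degrees of the points outside S and x.
If F consisted of S and all the k-sets that contain x and meet S, each of these
degrees would be exactly d. Every other member A of F(~x) adds
|A \ S| <= |S \ U| to this sum. On the other hand F misses the k-sets that
contain x and meet S but not U, and this already costs
at least (k-2) |S \ U| C(n-2k-1, k-2) ([unique_common_loss]). As the total has to exceed
that of the model, |F(~x)| >= (k-2) C(n-2k-1, k-2) + 2, and this for every x.

From above ([codegree_bound], [card_le_codegree]): the Kruskal-Katona theorem
bounds one of two cross-intersecting families when the other one is large
([cross_intersecting_bound]). For points x != y, the members of F that contain x
only cross-intersect those that contain y only, so one of the two parts has at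
most C(n-3, k-2) members. By the lower bound on F(~x) and F(~y), many members of F
then avoid both x and y; these cross-intersect the members that contain both,
which therefore number at most r C(n-3, k-3) for a small r. No point lies
in all members of F, so choosing a point of a fixed member, and then a point of a
member that misses the first point, gives |F| <= k^2 r C(n-3, k-3). For n >= c k^2
this is below (k-2) C(n-2k-1, k-2), with r = 2 if k >= 6 and r = 3 if k is 4
or 5 ([threshold_ge6], [threshold_45]).

The Kruskal-Katona theorem is proved in the form |F| >= C(x, k+1) implies
|shadow F| >= C(x, k) with x a natural number, which shifting towards a single
point reduces to an induction on x. *)

(** * Shadows and the Kruskal-Katona theorem *)

Definition shadow (T : finType) (F : {set {set T}}) : {set {set T}} :=
  [set C : {set T} | [exists u, (u \notin C) && (u |: C \in F)]].

Lemma shadowP (T : finType) (F : {set {set T}}) (C : {set T}) :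
  reflect (exists2 u, u \notin C & u |: C \in F) (C \in shadow F).
Proof.
rewrite inE; apply: (iffP existsP) => [[u /andP[]]|[u uC uF]]; first by exists u.
by exists u; rewrite uC.
Qed.

Lemma mem_shadow (T : finType) (F : {set {set T}}) (A : {set T}) (u : T) :
  A \in F -> u \in A -> A :\ u \in shadow F.
Proof. by move=> AF uA; apply/shadowP; exists u; rewrite ?setD11 // setD1K. Qed.

Lemma card_shadow_mem (T : finType) (F : {set {set T}}) k :
  (forall A, A \in F -> #|A| = k.+1) -> forall C, C \in shadow F -> #|C| = k.
Proof. by move=> unif C /shadowP[u uC /unif]; rewrite cardsU1 uC => -[]. Qed.

Lemma shadow_neq0 (T : finType) (F : {set {set T}}) k :
  (forall A, A \in F -> #|A| = k.+1) -> F != set0 -> shadow F != set0.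
Proof.
move=> unif /set0Pn[A AF].
have /set0Pn[u uA] : A != set0 by rewrite -card_gt0 (unif A).
by apply/set0Pn; exists (A :\ u); apply: mem_shadow.
Qed.

(** Replacing j by v in a set that contains j but not v is the action of the
transposition of v and j. Letting the transposition act on all sets makes the
operation an involution and keeps the two points symmetric. *)
Definition swap (T : finType) (v j : T) (A : {set T}) : {set T} :=
  tperm v j @^-1: A.

Lemma swapK (T : finType) (v j : T) : involutive (swap v j).
Proof. by move=> A; apply/setP => u; rewrite !inE tpermK. Qed.

Lemma card_swap (T : finType) (v j : T) (A : {set T}) : #|swap v j A| = #|A|.
Proof. by rewrite card_preimset //; apply: perm_inj. Qed.

Lemma swap_id (T : finType) (v j : T) (A : {set T}) :
  (v \in A) = (j \in A) -> swap v j A = A.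
Proof. by move=> vj; apply/setP => u; rewrite inE; case: tpermP => // ->. Qed.

Lemma swap_setU1 (T : finType) (v j u : T) (A : {set T}) :
  swap v j (u |: A) = tperm v j u |: swap v j A.
Proof. by apply/setP => w; rewrite !inE (canF_eq (tpermK v j)). Qed.

Lemma swap_outin (T : finType) (v j : T) (A : {set T}) :
  v \notin A -> j \in A -> swap v j A = v |: (A :\ j).
Proof.
move=> vA jA; apply/setP => w; rewrite !inE.
case: tpermP => [->|->|/eqP/negPf-> /eqP/negPf-> //]; first by rewrite jA eqxx.
by rewrite eqxx (negPf vA) orbF; apply/esym/eqP => jv; rewrite -jv jA in vA.
Qed.

(** The usual shift of j to v: if F contains exactly one of A and swap v j A, it
is replaced by the one of the two that contains v. *)
Definition shift (T : finType) (v j : T) (F : {set {set T}}) : {set {set T}} :=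
  [set A : {set T} | if v \in A then (A \in F) || (swap v j A \in F)
           else (A \in F) && (swap v j A \in F)].

Lemma card_indic (T : finType) (F : {set T}) : #|F| = \sum_(A : T) (A \in F).
Proof. by rewrite -sum1_card big_mkcond /=; apply: eq_bigr => A _; case: (_ \in _). Qed.

(** Summing over A and over swap v j A counts both families twice, and the two
summands at a given A agree: F and its shift have equally many members in
every pair {A, swap v j A}. *)
Lemma card_shift (T : finType) (v j : T) (F : {set {set T}}) : #|shift v j F| = #|F|.
Proof.
have dbl (G : {set {set T}}) :
    #|G| + #|G| = \sum_(A : {set T}) ((A \in G) + (swap v j A \in G)).
  rewrite big_split /= -card_indic; congr (_ + _).
  rewrite card_indic (reindex_inj (inv_inj (@swapK _ v j))) /=.
  by [].
suff : #|shift v j F| + #|shift v j F| = #|F| + #|F| by lia.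
rewrite !dbl; apply: eq_bigr => A _.
rewrite !inE swapK tpermL.
case: (boolP ((v \in A) == (j \in A))) => [/eqP vj|].
  by rewrite swap_id // -vj; case: (v \in A); case: (A \in F).
by case: (v \in A); case: (j \in A); case: (A \in F); case: (swap v j A \in F).
Qed.

Lemma shadow_shift (T : finType) (v j : T) (F : {set {set T}}) :
  shadow (shift v j F) \subset shift v j (shadow F).
Proof.
have swap_shadow C : (swap v j C \in shadow F)
    = [exists u, (u \notin C) && (swap v j (u |: C) \in F)].
  apply/shadowP/existsP => [[u uC uF]|[u /andP[uC uF]]].
    exists (tperm v j u); rewrite swap_setU1 tpermK uF andbT.
    by move: uC; rewrite inE.
  by exists (tperm v j u); rewrite ?inE ?tpermK // -swap_setU1.
have shI (C : {set T}) u : u \notin C -> u |: C \in F -> C \in shadow F.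
  by move=> uC uF; apply/shadowP; exists u.
have shJ (C : {set T}) u : u \notin C -> swap v j (u |: C) \in F -> swap v j C \in shadow F.
  by move=> uC uF; rewrite swap_shadow; apply/existsP; exists u; rewrite uC.
apply/subsetP => C /shadowP[u uC]; rewrite inE [C \in shift _ _ _]inE in_setU1.
case: (boolP (v \in C)) => [vC|vC]; rewrite ?orbT ?orbF.
  by case/orP => h; apply/orP; [left; apply: shI h | right; apply: shJ h].
case: (eqVneq v u) => [vu|_]; last first.
  by case/andP => h1 h2; apply/andP; split; [apply: shI h1 | apply: shJ h2].
case: (boolP (j \in C)) => jC.
  have -> : swap v j (u |: C) = u |: C.
    by apply: swap_id; rewrite !inE vu eqxx jC orbT.
  rewrite orbb => h; rewrite (shI C u) //= (shJ C u) // swap_id //.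
  by rewrite !inE vu eqxx jC orbT.
have e : swap v j C = C by apply: swap_id; rewrite (negPf vC) (negPf jC).
rewrite e andbb => /orP[|] h; first exact: shI h.
by rewrite -e; apply: shJ h.
Qed.

(** F is fixed by every shift to v. *)
Definition stable (T : finType) (v : T) (F : {set {set T}}) :=
  forall A u, A \in F -> v \notin A -> u \in A -> v |: (A :\ u) \in F.

(** A shift that changes F lowers the number of members that avoid v, so shifting to
v repeatedly comes to an end. *)
Lemma exists_stable (T : finType) (v : T) (F : {set {set T}}) k :
  (forall A, A \in F -> #|A| = k) ->
  exists F' : {set {set T}},
    [/\ forall A, A \in F' -> #|A| = k, #|F'| = #|F|,
        #|shadow F'| <= #|shadow F| & stable v F'].
Proof.
have [N] := ubnP #|[set A in F | v \notin A]|.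
elim: N F => // N IH F; rewrite ltnS => leN unif.
case: (boolP [exists A in F, [exists u in A,
          (v \notin A) && (swap v u A \notin F)]]) => [|noA]; last first.
  exists F; split=> // A u AF vA uA; rewrite -swap_outin //.
  apply: contraNT noA => sF; apply/existsP; exists A; rewrite AF.
  by apply/existsP; exists u; rewrite uA vA.
case/exists_inP => A AF /exists_inP[j jA /andP[vA sF]].
case: (IH (shift v j F)).
- apply: leq_trans leN; apply: proper_card; apply/properP; split.
    apply/subsetP => B; rewrite !inE => /andP[+ vB].
    by rewrite (negPf vB) => /andP[->].
  by exists A; rewrite !inE ?AF ?(negPf vA) ?(negPf sF).
- move=> B; rewrite inE.
  by case: ifP => _; [case/orP | case/andP]=> [/unif|/unif|/unif] //; rewrite card_swap.
move=> F' [unif' cardF' shF' st]; exists F'; split=> //.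
  by rewrite cardF' card_shift.
apply: leq_trans shF' _; rewrite -(card_shift v j (shadow F)).
exact/subset_leq_card/shadow_shift.
Qed.

Definition link (T : finType) (v : T) (F : {set {set T}}) : {set {set T}} :=
  [set C : {set T} | (v \notin C) && (v |: C \in F)].

Lemma card_link (T : finType) (v : T) (F : {set {set T}}) :
  #|link v F| = #|[set A in F | v \in A]|.
Proof.
rewrite -(@card_in_imset _ _ (fun C => v |: C) (mem (link v F))).
  apply: eq_card => A; rewrite !inE; apply/imsetP/andP => [[C]|[AF vA]].
    by rewrite inE => /andP[vC CF] ->; rewrite setU11.
  by exists (A :\ v); rewrite ?inE ?setD11 ?setD1K ?eqxx.
move=> B C; rewrite !inE => /andP[vB _] /andP[vC _] /(congr1 (fun A => A :\ v)).
by rewrite !setU1K.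
Qed.

Lemma card_split (T : finType) (F : {set {set T}}) (v : T) :
  #|F| = #|[set A in F | v \in A]| + #|[set A in F | v \notin A]|.
Proof.
rewrite -(cardsID [set A : {set T} | v \in A] F); congr (_ + _);
by apply: eq_card => A; rewrite !inE // andbC.
Qed.

(** Let F be stable at v, let L be the link of v and G the part of F that avoids v.
Stability puts the shadow of G inside L. If |L| < C(x, k+1), then |G| > C(x, k+2)
and by induction the shadow of G would be larger than L. So |L| >= C(x, k+1), and
the shadow of F contains L together with the sets v |: D for D in the shadow of
L; Pascal's rule adds up the two counts. *)
Lemma kruskal_katona (T : finType) x k (F : {set {set T}}) :
  (forall A, A \in F -> #|A| = k.+1) -> F != set0 ->
  'C(x, k.+1) <= #|F| -> 'C(x, k) <= #|shadow F|.
Proof.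
elim: x k F => [|x IH] [|k] F unif F0 leF;
  (* If x = 0 or k = 0, the claim is at most that the shadow is nonempty. *)
  rewrite ?bin0 ?bin0n ?card_gt0 //; try exact: shadow_neq0 unif F0.
have [v _] : exists v : T, True.
  case/set0Pn: F0 => A /unif cA.
  have /set0Pn[v _] : A != set0 by rewrite -card_gt0 cA.
  by exists v.
have [F' [unif' cardF' shF' st]] := exists_stable v unif.
rewrite -cardF' in leF.
have {}F0 : F' != set0 by rewrite -card_gt0 cardF' card_gt0.
apply: leq_trans shF' => {F unif cardF'}.
move: F' unif' leF F0 st => F unif leF F0 st.
set G := [set A in F | v \notin A].
have cF : #|F| = #|link v F| + #|G| by rewrite card_link; apply: card_split.
have shG : shadow G \subset link v F.
  apply/subsetP => C /shadowP[u uC]; rewrite !inE negb_or => /andP[CF /andP[vu vC]].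
  rewrite vC /=; have := st _ u CF; rewrite !inE negb_or vu vC eqxx /=.
  by rewrite setU1K //; apply.
have unifG A : A \in G -> #|A| = k.+2 by rewrite inE => /andP[/unif].
have unifL C : C \in link v F -> #|C| = k.+1.
  by rewrite inE => /andP[vC /unif]; rewrite cardsU1 vC => -[].
have L0 : link v F != set0.
  apply: contraNneq F0 => L0; rewrite -cards_eq0 cF L0 cards0 add0n cards_eq0.
  apply: contraTT shG => /(shadow_neq0 unifG); rewrite L0 subset0.
  by [].
have leL : 'C(x, k.+1) <= #|link v F|.
  rewrite leqNgt; apply/negP => ltL.
  have ltG : 'C(x, k.+2) < #|G| by move: leF; rewrite cF binS; lia.
  have := IH _ G unifG _ (ltnW ltG).
  rewrite -card_gt0 (leq_ltn_trans _ ltG) // => /(_ isT).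
  by move/leq_trans/(_ (subset_leq_card shG)); lia.
have leS := IH _ _ unifL L0 leL.
rewrite binS (card_split (shadow F) v) -card_link addnC leq_add //.
  apply: leq_trans leS _; apply/subset_leq_card/subsetP => D /shadowP[u uD].
  rewrite !inE negb_or => /andP[/andP[vu vD] uF]; rewrite vD.
  apply/existsP; exists u; rewrite !inE negb_or uD eq_sym vu /=.
  by rewrite setUCA.
apply: leq_trans leL _; apply/subset_leq_card/subsetP => D.
rewrite !inE => /andP[vD DF]; rewrite vD andbT.
by apply/existsP; exists v; rewrite vD.
Qed.

Lemma kruskal_katona_iter (T : finType) x k l (F : {set {set T}}) :
  (forall A, A \in F -> #|A| = k) -> F != set0 -> l <= k ->
  'C(x, k) <= #|F| ->
  'C(x, l) <= #|[set C : {set T} | (#|C| == l) && [exists A in F, C \subset A]]|.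
Proof.
elim: k F => [|k IH] F unif F0; rewrite leq_eqVlt.
  rewrite orbF => /eqP-> /leq_trans; apply; apply/subset_leq_card/subsetP => A AF.
  by rewrite inE (unif A) // eqxx; apply/exists_inP; exists A.
case/orP => [/eqP->|lk] leF.
  apply: leq_trans leF _; apply/subset_leq_card/subsetP => A AF.
  by rewrite inE (unif A) // eqxx; apply/exists_inP; exists A.
have := IH _ (card_shadow_mem unif) (shadow_neq0 unif F0) lk (kruskal_katona unif F0 leF).
move/leq_trans; apply; apply/subset_leq_card/subsetP => C; rewrite !inE.
case/andP=> -> /exists_inP[A /shadowP[u uA AF] CA]; apply/exists_inP.
by exists (u |: A) => //; apply: subset_trans CA (subsetUr _ _).
Qed.

(** * Cross-intersecting families and codegrees *)

Definition trace (T : finType) (F : {set {set T}}) (D P : {set T}) : {set {set T}} :=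
  [set A in F | A :&: D == P].

Lemma card_traceI (T : finType) (A D P : {set T}) :
  A :&: D = P -> #|A :&: ~: D| = #|A| - #|P|.
Proof. by move=> <-; rewrite -setDE cardsD. Qed.

Lemma trace_inj (T : finType) (F : {set {set T}}) (D P : {set T}) :
  {in trace F D P &, injective (fun A => A :&: ~: D)}.
Proof.
move=> A B; rewrite !inE => /andP[_ /eqP AP] /andP[_ /eqP BP] e.
by rewrite -(setID A D) -(setID B D) AP BP !setDE e.
Qed.

(** The parts A and B of F with traces P and Q on D cross-intersect outside D.
So no member of A, restricted to the complement of D, lies in the complement of a
member of B. If B is at least as large as the family of all sets through r fixed
points of the m-set, then Kruskal-Katona, applied to the complements of the
members of B, excludes as many sets from A as there are sets that miss these r
points. *)
Lemma cross_intersecting_bound (T : finType) (F : {set {set T}}) (D P Q : {set T})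
    k m r :
  (forall A, A \in F -> #|A| = k) ->
  (forall A B, A \in F -> B \in F -> A :&: B != set0) ->
  P :&: Q = set0 -> #|~: D| = m -> (k - #|P|) + (k - #|Q|) <= m ->
  0 < 'C(m - r, m - (k - #|Q|)) <= #|trace F D Q| ->
  #|trace F D P| + 'C(m - r, k - #|P|) <= 'C(m, k - #|P|).
Proof.
move=> unif int PQ cD lem /andP[C0 leQ].
pose N := [set ~: D :\: B | B in trace F D Q].
have cN : #|N| = #|trace F D Q|.
  apply: card_in_imset => A B AQ BQ /(congr1 (fun C => ~: D :\: C)).
  rewrite /= !setDDr !setDv !set0U [_ :&: A]setIC [_ :&: B]setIC.
  exact: (trace_inj AQ BQ).
have unifN C : C \in N -> #|C| = m - (k - #|Q|).
  case/imsetP => B; rewrite inE => /andP[BF /eqP BQ] ->.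
  by rewrite cardsD cD setIC (card_traceI BQ) (unif B).
have N0 : N != set0 by rewrite -card_gt0 cN (leq_trans C0).
have lk : k - #|P| <= m - (k - #|Q|) by lia.
rewrite -cN in leQ.
have := kruskal_katona_iter unifN N0 lk leQ.
set Z := [set C : {set T} | _] => leZ.
pose Y := [set A :&: ~: D | A in trace F D P].
have cY : #|Y| = #|trace F D P| by apply/card_in_imset/trace_inj.
apply: leq_trans (leq_add (leqnn _) leZ) _; rewrite -cY -cardsUI -cD -cards_draws.
have -> : Y :&: Z = set0.
  apply/setP => C; rewrite !inE; apply/negP => /andP[/imsetP[A]].
  rewrite inE => /andP[AF /eqP AP] -> /andP[_ /exists_inP[E /imsetP[B +] ->]].
  rewrite inE => /andP[BF /eqP BQ] /subsetP sub.
  case/set0Pn: (int A B AF BF) => u; rewrite inE => /andP[uA uB].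
  case: (boolP (u \in D)) => uD.
    have : u \in P :&: Q by rewrite -AP -BQ !inE uA uB uD.
    by rewrite PQ inE.
  by have := sub u; rewrite !inE uA uD uB /=; move/(_ isT).
rewrite cards0 addn0; apply/subset_leq_card/subsetP => C; rewrite !inE.
case/orP => [/imsetP[A]|/andP[-> /exists_inP[E /imsetP[B _ ->] sub]]].
  rewrite inE => /andP[AF /eqP AP] ->.
  by rewrite subsetIr (card_traceI AP) (unif A) //=.
by rewrite (subset_trans sub (subsetDl _ _)).
Qed.

(** Among the (l+1)-subsets of m + r points, count separately those that meet r
given points. *)
Lemma bin_add_le m r l : 'C(m + r, l.+1) <= 'C(m, l.+1) + r * 'C(m + r - 1, l).
Proof.
elim: r => [|r IH]; first by rewrite addn0 leq_addr.
rewrite addnS binS subn1 /= mulSn.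
have : 'C(m + r - 1, l) <= 'C(m + r, l) by apply: leq_bin2l; lia.
move/(leq_mul (leqnn r)); lia.
Qed.

Lemma card_trace_split (T : finType) (F : {set {set T}}) (x y : T) : x != y ->
  #|[set A in F | x \notin A]| =
  #|trace F [set x; y] set0| + #|trace F [set x; y] [set y]|.
Proof.
move=> xy; rewrite (card_split [set A in F | x \notin A] y) addnC.
have tr (P : {set T}) (A : {set T}) : (A :&: [set x; y] == P) =
    [&& P \subset [set x; y], (x \in A) == (x \in P) & (y \in A) == (y \in P)].
  apply/eqP/and3P => [<-|[sP /eqP xP /eqP yP]].
    by rewrite subsetIr !inE !eqxx orbT !andbT.
  apply/setP => u; rewrite !inE.
  case: (eqVneq u x) => [->|ux]; first by rewrite andbT.
  case: (eqVneq u y) => [->|uy]; first by rewrite andbT.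
  rewrite andbF; apply/esym/negP => /(subsetP sP).
  by rewrite !inE (negPf ux) (negPf uy).
congr (_ + _); apply: eq_card => A; rewrite !inE tr !inE -?andbA.
  by rewrite sub0set /=; case: (x \in A); case: (y \in A).
by rewrite sub1set !inE (negPf xy) !eqxx orbT /=; case: (x \in A); case: (y \in A).
Qed.

(** [L] stands for the lower bound of the families of members that avoid a point.
Cross-intersection is used twice: with r = 1, for the members through exactly one
of x and y, to leave C(n-2-r, k-r) members that avoid both; and then for these
members against those that contain both. *)
Lemma codegree_bound (T : finType) (F : {set {set T}}) k r L :
  (forall A, A \in F -> #|A| = k) ->
  (forall A B, A \in F -> B \in F -> A :&: B != set0) ->
  2 < k -> 0 < r <= k -> k + k <= #|T| ->
  (forall x, L <= #|[set A in F | x \notin A]|) ->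
  'C(#|T| - 2 - r, k - r) + 'C(#|T| - 3, k - 2) <= L ->
  forall x y, x != y ->
  #|[set A in F | (x \in A) && (y \in A)]| <= r * 'C(#|T| - 3, k - 3).
Proof.
set n := #|T|; move=> unif int k2 rk kn leL numL x y xy.
wlog leC : x y xy / #|trace F [set x; y] [set y]| <= 'C(n - 3, k - 2).
  (* If the members through y only are many, those through x only are few. *)
  move=> W; case: (leqP #|trace F [set x; y] [set y]| 'C(n - 3, k - 2)) => [/W->//|gtC].
  have -> : [set A in F | (x \in A) && (y \in A)] = [set A in F | (y \in A) && (x \in A)].
    by apply/setP => A; rewrite !inE [(x \in A) && _]andbC.
  apply: W; first by rewrite eq_sym.
  rewrite setUC.
  have cD : #|~: [set x; y]| = n - 2 by rewrite cardsCs setCK cards2 xy.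
  have dis : [set x] :&: [set y] = set0.
    by apply/setP => u; rewrite !inE; case: eqP => // ->; apply/negbTE.
  have := @cross_intersecting_bound T F [set x; y] [set x] [set y] k _ 1 unif int dis cD.
  rewrite !cards1.
  have -> : 'C(n - 2 - 1, n - 2 - (k - 1)) = 'C(n - 3, k - 2).
    rewrite -[RHS]bin_sub; last by lia.
    by congr 'C(_, _); lia.
  rewrite (ltnW gtC) bin_gt0.
  have -> : n - 2 = (n - 3).+1 by lia.
  have -> : k - 1 = (k - 2).+1 by lia.
  rewrite binS.
  have -> : (n - 3).+1 - 1 = n - 3 by lia.
  have -> : k - 2 <= n - 3 by lia.
  by move=> /(_ _ isT); lia.
have leB : 'C(n - 2 - r, k - r) <= #|trace F [set x; y] set0|.
  have := leL x; rewrite (card_trace_split F xy); lia.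
have cD : #|~: [set x; y]| = n - 2 by rewrite cardsCs setCK cards2 xy.
have := @cross_intersecting_bound T F [set x; y] [set x; y] set0 k _ r unif int (setI0 _) cD.
rewrite cards0 cards2 xy subn0 /=.
have -> : 'C(n - 2 - r, n - 2 - k) = 'C(n - 2 - r, k - r).
  rewrite -[RHS]bin_sub; last by lia.
  by congr 'C(_, _); lia.
have trE : trace F [set x; y] [set x; y] = [set A in F | (x \in A) && (y \in A)].
  apply/setP => A; rewrite !inE; congr (_ && _).
  by apply/eqP/andP => [/setIidPr|[xA yA]];
    [|apply/setIidPr]; rewrite subUset !sub1set; [move/andP | rewrite xA].
rewrite leB bin_gt0 trE.
have -> : k - r <= n - 2 - r by lia.
move=> /(_ _ isT) H.
have := bin_add_le (n - 2 - r) r (k - 3).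
have -> : n - 2 - r + r = n - 2 by lia.
have -> : n - 2 - 1 = n - 3 by lia.
have -> : (k - 3).+1 = k - 2 by lia.
have /H : k - 2 + k <= n - 2 by lia.
move=> h1 h2; rewrite -(leq_add2r 'C(n - 2 - r, k - 2)) (leq_trans h1) //.
by rewrite addnC.
Qed.

(** Every member meets a fixed member S in some x, and meets a member missing x in
some y; so F is covered by k^2 pairs of distinct points. *)
Lemma card_le_codegree (T : finType) (F : {set {set T}}) k p :
  (forall A, A \in F -> #|A| = k) ->
  (forall A B, A \in F -> B \in F -> A :&: B != set0) ->
  (forall x, exists2 A, A \in F & x \notin A) ->
  (forall x y, x != y -> #|[set A in F | (x \in A) && (y \in A)]| <= p) ->
  #|F| <= k * (k * p).
Proof.
move=> unif int ncov cod.
case: (set_0Vmem F) => [->|[S SF]]; first by rewrite cards0.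
have cover (G : {set {set T}}) (A : {set T}) q : A \in F ->
    (forall B, B \in G -> A :&: B != set0) ->
    (forall x, x \in A -> #|[set B in G | x \in B]| <= q) -> #|G| <= k * q.
  move=> AF meet deg; rewrite -(unif A AF) -sum_nat_const.
  apply: leq_trans (leq_sum _ _) => //; last by move=> x xA; apply: deg xA.
  rewrite card_indic.
  under [X in _ <= X]eq_bigr => x _ do rewrite card_indic.
  rewrite exchange_big /=; apply: leq_sum => B _.
  case: (boolP (B \in G)) => // BG; case/set0Pn: (meet B BG) => x /setIP[xA xB].
  by rewrite (bigD1 x) //= inE BG xB.
apply: (cover F S _ SF) => [B BF|x _]; first exact: int.
have [A AF xA] := ncov x.
apply: (cover _ A _ AF) => [B|y yA]; first by rewrite inE => /andP[BF _]; apply: int.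
have xy : x != y by apply: contraNneq xA => ->.
apply: leq_trans (cod x y xy); apply/subset_leq_card/subsetP => B.
by rewrite !inE andbA.
Qed.

(** * Estimates for binomial coefficients *)

(** A Bernoulli inequality: C(a, j+1) is at least 1 - c (j+1) / (a + c) times
C(a + c, j+1). *)
Lemma bin_ratio (a c j : nat) :
  (a + c) * 'C(a + c, j.+1) <= (a + c) * 'C(a, j.+1) + c * j.+1 * 'C(a + c, j.+1).
Proof.
have := leq_mul (leqnn (a + c)) (bin_add_le a c j).
rewrite mulnDr mulnCA subn1 mul_bin_diag; lia.
Qed.

(** Both inequalities are multiplied by n - 2, which turns them into multiples of
N = C(n-2, k-2): (n-2) C(n-3, k-3) is (k-2) N, and by [bin_ratio]
(n-2) C(n-2k-1, k-2) is at least 2 k^2 N, and C(n-2k-1, k-2) at least N / 2. *)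
Lemma threshold_ge6 n k : 6 <= k -> 4 * k ^ 2 <= n ->
  'C(n - 2 - 2, k - 2) + 'C(n - 3, k - 2) <= (k - 2) * 'C(n - 2 * k - 1, k - 2) + 2
  /\ k * (k * (2 * 'C(n - 3, k - 3))) <= (k - 2) * 'C(n - 2 * k - 1, k - 2).
Proof.
move=> k6; rewrite expnS expn1 => nk.
have := bin_ratio (n - 2 * k - 1) (2 * k - 1) (k - 3).
have := mul_bin_diag (n - 2) (k - 3).
have -> : n - 2 * k - 1 + (2 * k - 1) = n - 2 by nia.
have -> : (k - 3).+1 = k - 2 by lia.
have -> : (n - 2).-1 = n - 3 by lia.
have : 'C(n - 3, k - 2) <= 'C(n - 2, k - 2) by apply: leq_bin2l; lia.
have : 'C(n - 2 - 2, k - 2) <= 'C(n - 2, k - 2) by apply: leq_bin2l; lia.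
set N := 'C(n - 2, k - 2); set B := 'C(n - 2 * k - 1, k - 2).
set Q := 'C(n - 3, k - 3) => l1 l2 eQ leB.
have m0 : 0 < n - 2 by nia.
have leBN : 2 * (k * k) * N <= (n - 2) * B.
  have : (2 * k - 1) * (k - 2) + 2 * (k * k) <= n - 2 by nia.
  move/(leq_mul (leqnn N)); nia.
split.
  have le2 : N <= 2 * B.
    rewrite -(leq_pmul2l m0).
    have : 2 * ((2 * k - 1) * (k - 2)) <= n - 2 by nia.
    move/(leq_mul (leqnn N)); nia.
  have : 4 * B <= (k - 2) * B by apply: leq_mul; lia.
  lia.
rewrite -(leq_pmul2l m0).
have -> : (n - 2) * (k * (k * (2 * Q))) = (k - 2) * (2 * (k * k) * N) by nia.
by rewrite [leqRHS]mulnCA leq_mul.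
Qed.

(** Let N = C(n-2, k-2). For r = 2 the left-hand side of the first inequality would be
almost 2 N, and for k = 4 the right-hand side falls short of it; for r = 3 the
left-hand side is little more than N. The larger r in the second inequality is paid
for by n >= 30 k^2. *)
Lemma threshold_45 n k : (k == 4) || (k == 5) -> 30 * k ^ 2 <= n ->
  'C(n - 2 - 3, k - 3) + 'C(n - 3, k - 2) <= (k - 2) * 'C(n - 2 * k - 1, k - 2) + 2
  /\ k * (k * (3 * 'C(n - 3, k - 3))) <= (k - 2) * 'C(n - 2 * k - 1, k - 2).
Proof.
move=> k45 nk.
have n480 : 480 <= n by case/orP: k45 nk => /eqP ->; lia.
have k5 : 4 <= k <= 5 by case/orP: k45 => /eqP ->.
have := bin_ratio (n - 2 * k - 1) (2 * k - 1) (k - 3).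
have := mul_bin_diag (n - 2) (k - 3).
have -> : n - 2 * k - 1 + (2 * k - 1) = n - 2 by lia.
have -> : (k - 3).+1 = k - 2 by lia.
have -> : (n - 2).-1 = n - 3 by lia.
have : 'C(n - 3, k - 2) <= 'C(n - 2, k - 2) by apply: leq_bin2l; lia.
have : 'C(n - 2 - 3, k - 3) <= 'C(n - 3, k - 3) by apply: leq_bin2l; lia.
set N := 'C(n - 2, k - 2); set B := 'C(n - 2 * k - 1, k - 2).
set Q := 'C(n - 3, k - 3) => l1 l2 eQ leB.
have m0 : 0 < n - 2 by lia.
have m2 : 478 * N <= (n - 2) * N by rewrite leq_mul //; lia.
suff [h1 h2] : Q + N <= (k - 2) * B /\ k * (k * (3 * Q)) <= (k - 2) * B by lia.
have eB : (n - 2) * ((k - 2) * B) = (k - 2) * ((n - 2) * B) by rewrite mulnCA.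
have eQ3 : (n - 2) * (k * (k * (3 * Q))) = k * (k * (3 * ((k - 2) * N))).
  by rewrite -eQ (mulnCA _ k) (mulnCA _ k) (mulnCA _ 3).
rewrite -(@leq_pmul2l _ (Q + N) _ m0) -(@leq_pmul2l _ (k * _) _ m0) mulnDr eB eQ3 eQ.
clear eB eQ3 eQ l1 l2.
move: ((n - 2) * N) ((n - 2) * B) leB m2 => mN mB.
by case/orP: k45 => /eqP -> /=; lia.
Qed.

(** * Degrees in the extremal family *)

Lemma card_between (T : finType) (P Q : {set T}) k : P \subset Q -> #|P| <= k ->
  #|[set A : {set T} | [&& P \subset A, A \subset Q & #|A| == k]]|
  = 'C(#|Q| - #|P|, k - #|P|).
Proof.
move=> PQ Pk.
have cQP : #|Q :\: P| = #|Q| - #|P| by rewrite cardsD (setIidPr PQ).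
rewrite -cQP -cards_draws -[RHS](@card_in_imset _ _ (fun C => P :|: C)).
  apply: eq_card => A; rewrite inE; apply/and3P/imsetP => [[PA AQ /eqP cA]|[C]].
    exists (A :\: P).
      by rewrite inE setSD //= cardsD (setIidPr PA) cA.
    by rewrite -{1}(setIidPr PA) setID.
  rewrite inE subsetD => /andP[/andP[CQ dis] /eqP cC] ->.
  rewrite subsetUl subUset PQ CQ cardsU setIC; split=> //.
  have -> : C :&: P = set0 by apply/eqP; rewrite setI_eq0.
  by rewrite cC cards0; lia.
move=> B C; rewrite !inE !subsetD => /andP[/andP[_ dB] _] /andP[/andP[_ dC] _].
move/(congr1 (fun A => A :\: P)); rewrite !setDUl !setDv !set0U.
by move/setDidPl: dB => ->; move/setDidPl: dC => ->.
Qed.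

Definition star_meeting (T : finType) k (x : T) (S : {set T}) : {set {set T}} :=
  [set A : {set T} | [&& #|A| == k, x \in A & A :&: S != set0]].

(** Subtract, from the k-sets through x and y, those that avoid S. *)
Lemma degree_star_meeting (T : finType) k (x y : T) (S : {set T}) :
  1 < k -> #|S| = k -> x \notin S -> y \notin S -> x != y ->
  #|[set A in star_meeting k x S | y \in A]|
  = 'C(#|T| - 2, k - 2) - 'C(#|T| - k - 2, k - 2).
Proof.
move=> k1 cS xS yS xy.
pose W (Q : {set T}) : {set {set T}} :=
  [set A : {set T} | [&& [set x; y] \subset A, A \subset Q & #|A| == k]].
have cW (Q : {set T}) : [set x; y] \subset Q -> #|W Q| = 'C(#|Q| - 2, k - 2).
  by move=> PQ; rewrite card_between ?cards2 ?xy.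
have -> : [set A in star_meeting k x S | y \in A] = W setT :\: W (~: S).
  apply/setP => A; rewrite !inE subsetT subUset !sub1set -disjoints_subset -setI_eq0.
  by case: (x \in A); case: (y \in A); case: (_ == set0); case: (_ == k).
rewrite cardsD (setIidPr _); last first.
  by apply/subsetP => A; rewrite !inE subsetT => /and3P[-> _ ->].
rewrite !cW ?subsetT ?cardsT //; last by rewrite subUset !sub1set !inE xS yS.
by rewrite cardsCs setCK cS.
Qed.

(** * Families of large minimum degree *)

Lemma sum_degrees (T : finType) (F : {set {set T}}) (Y : {set T}) :
  \sum_(y in Y) #|[set A in F | y \in A]| = \sum_(A in F) #|A :&: Y|.
Proof.
under eq_bigr => y _ do rewrite card_indic.
rewrite exchange_big /= [RHS]big_mkcond /=; apply: eq_bigr => A _.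
under eq_bigr => y _ do rewrite inE.
case: (A \in F) => /=; last by rewrite big1.
rewrite big_mkcond card_indic; apply: eq_bigr => y _.
by rewrite inE andbC; case: (y \in Y).
Qed.

(** It is enough to count the sets A that meet S in a single point s, which lies
outside U, and that contain x and k - 2 points outside S and U: these k - 2 points
are what A contributes, and s can be read off from A. *)
Lemma unique_common_loss (T : finType) k (x : T) (S U : {set T}) :
  1 < k -> #|S| = k -> #|U| = k -> x \notin S -> x \notin U ->
  (k - 2) * (#|S :\: U| * 'C(#|T| - 2 * k - 1, k - 2))
  <= \sum_(A in star_meeting k x S | A :&: U == set0) #|A :&: ~: (x |: S)|.
Proof.
move=> k1 cS cU xS xU.
pose L s : {set {set T}} := [set A : {set T} |
  [&& [set x; s] \subset A, A \subset s |: ~: (S :|: U) & #|A| == k]].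
have cL s : s \in S :\: U -> 'C(#|T| - 2 * k - 1, k - 2) <= #|L s|.
  rewrite inE => /andP[sU sS].
  have xs : x != s by apply: contraNneq xS => ->.
  have sSU : s \notin ~: (S :|: U) by rewrite !inE sS.
  rewrite card_between ?cards2 ?xs //; last first.
    by rewrite subUset !sub1set !inE eqxx (negPf xs) (negPf xS) (negPf xU).
  apply: leq_bin2l; rewrite cardsU1 sSU (cardsCs (~: _)) setCK cardsU cS cU.
  by rewrite /=; lia.
have inter A s : s \in S :\: U -> A \in L s -> A :&: S = [set s].
  rewrite !inE => /andP[sU sS] /and3P[xsA /subsetP AQ _].
  apply/setP => u; rewrite !inE; apply/andP/eqP => [[uA uS]|->].
    by have := AQ u uA; rewrite !inE uS /= orbF => /eqP.
  by split=> //; apply: (subsetP xsA); rewrite !inE eqxx orbT.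
rewrite -sum_nat_const big_distrr /=.
apply: (@leq_trans (\sum_(s in S :\: U) \sum_(A in L s) (k - 2))).
  by apply: leq_sum => s sSU; rewrite sum_nat_const mulnC leq_mul ?cL.
under eq_bigr => s _ do rewrite big_mkcond.
rewrite exchange_big /= [leqRHS]big_mkcond; apply: leq_sum => A _.
case: (boolP [exists s in S :\: U, A \in L s]) => [|none]; last first.
  rewrite big1 // => s sSU; case: ifP => // AL.
  by case/exists_inP: none; exists s.
case/exists_inP => s sSU AL; rewrite (bigD1 s) //= AL big1 ?addn0; last first.
  move=> t /andP[tSU ts]; case: ifP => // AL'.
  have := inter _ _ tSU AL'; rewrite (inter _ _ sSU AL) => /set1_inj e.
  by rewrite e eqxx in ts.
have AS := inter _ _ sSU AL.
move: AL sSU; rewrite !inE subUset !sub1set => /and3P[/andP[xA sA] AQ cA] /andP[sU sS].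
rewrite cA xA AS -card_gt0 cards1 /=.
have -> : A :&: U == set0.
  rewrite setI_eq0 disjoints_subset; apply/subsetP => u /(subsetP AQ).
  by rewrite !inE negb_or => /orP[/eqP->|/andP[]].
rewrite setCU setIA -!setDE [leqRHS]cardsD.
have -> : (A :\ x) :&: S = [set s].
  by rewrite -AS setIDAC; apply/setDidPl; rewrite disjoint_sym disjoints1 !inE (negPf xS) andbF.
by rewrite cards1 -(eqP cA) (cardsD1 x) xA; lia.
Qed.

(** Double count the incidences between F and the complement Y of x |: S, against
those of all the k-sets that contain x and meet S. *)
Lemma diversity_lower_bound (T : finType) (F : {set {set T}}) k (x : T) :
  1 < k -> k.+1 < #|T| ->
  (forall A, A \in F -> #|A| = k) ->
  (forall A B, A \in F -> B \in F -> A :&: B != set0) ->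
  (exists2 A, A \in F & x \notin A) ->
  (forall y, 'C(#|T| - 2, k - 2) - 'C(#|T| - k - 2, k - 2)
             < #|[set A in F | y \in A]|) ->
  (k - 2) * 'C(#|T| - 2 * k - 1, k - 2) + 2 <= #|[set A in F | x \notin A]|.
Proof.
move=> k1 kn unif int [A0 A0F xA0] deg.
set G := [set A in F | x \notin A].
have A0G : (A0, A0) \in setX G G by rewrite !inE A0F xA0.
pose d := fun p : {set T} * {set T} => #|p.1 :\: p.2|.
case: (@arg_maxnP _ (A0, A0) (mem (setX G G)) d A0G) => -[S U] /=.
rewrite inE /= => /andP[SG UG] dmax.
have {}dmax A : A \in G -> #|A :\: S| <= #|S :\: U|.
  by move=> AG; apply: (dmax (A, S)); rewrite inE /= AG.
move: (SG) (UG); rewrite !inE => /andP[SF xS] /andP[UF xU].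
have cS := unif S SF; have cU := unif U UF.
set D := 'C(_, _) - _ in deg.
(* S itself contributes nothing to the sum over Y, hence |G| - 1 in [sumG]. *)
pose Y := ~: (x |: S).
have cY : 0 < #|Y| by rewrite cardsCs setCK cardsU1 xS cS; lia.
have sumF : #|Y| * D.+1 <= \sum_(A in F) #|A :&: Y|.
  by rewrite -sum_degrees -sum_nat_const leq_sum.
have sumH : \sum_(A in star_meeting k x S) #|A :&: Y| = #|Y| * D.
  rewrite -sum_degrees -sum_nat_const; apply: eq_bigr => y.
  rewrite !inE negb_or => /andP[yx yS].
  by apply: degree_star_meeting => //; rewrite eq_sym.
have loss := unique_common_loss k1 cS cU xS xU.
rewrite -/Y in loss.
have sumX : \sum_(A in F | x \in A) #|A :&: Y| +
    \sum_(A in star_meeting k x S | A :&: U == set0) #|A :&: Y| <= #|Y| * D.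
  rewrite -sumH [leqRHS](bigID (fun A => A :&: U == set0)) /= [leqRHS]addnC leq_add2r.
  rewrite [leqLHS]big_mkcond [leqRHS]big_mkcond; apply: leq_sum => A _.
  case: ifP => // /andP[AF xA]; rewrite inE (unif A AF) eqxx xA.
  by rewrite (int A S) ?(int A U).
have sumG : \sum_(A in F | x \notin A) #|A :&: Y| <= #|S :\: U| * (#|G| - 1).
  have -> : \sum_(A in F | x \notin A) #|A :&: Y| = \sum_(A in G) #|A :\: S|.
    rewrite [RHS](eq_bigl (fun A => (A \in F) && (x \notin A))); last first.
      by move=> A; rewrite inE.
    apply: eq_bigr => A /andP[_ xA].
    rewrite /Y setCU setIA -!setDE; congr #|pred_of_set (_ :\: _)|.
    by apply/setDidPl; rewrite disjoint_sym disjoints1.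
  rewrite (bigD1 S) //= setDv cards0 add0n.
  rewrite (cardsD1 S G) SG addKn mulnC -sum_nat_const.
  rewrite [leqLHS](eq_bigl (fun A => A \in G :\ S)) => [|A]; last by rewrite !inE andbC.
  by apply: leq_sum => A /setD1P[_ /dmax].
rewrite (bigID (fun A : {set T} => x \in A)) /= in sumF.
set q := 'C(_ - 2 * k - 1, _) in loss *.
have lt : #|S :\: U| * ((k - 2) * q) < #|S :\: U| * (#|G| - 1).
  rewrite -(ltn_add2l (\sum_(A in F | x \in A) #|A :&: Y|)).
  apply: leq_trans (leq_trans sumF (leq_add (leqnn _) sumG)).
  rewrite mulnS -add1n leq_add //; apply: leq_trans sumX.
  by rewrite leq_add2l mulnCA.
by move: lt; rewrite ltn_mul2l ltn_subRL add1n addn2 => /andP[_].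
Qed.

(** * The minimum degree *)

Lemma min_degree_le n (F : {set {set 'I_n}}) y : min_degree F <= degree F y.
Proof.
rewrite /min_degree; have := mem_index_enum y.
elim: (index_enum _) => // z s IH; rewrite inE big_cons geq_min => /orP[/eqP->|/IH->].
  by rewrite leqnn.
by rewrite orbT.
Qed.

Lemma min_degree_ge n (F : {set {set 'I_n}}) c (y : 'I_n) :
  (forall z, c <= degree F z) -> c <= min_degree F.
Proof.
move=> cF; apply: (big_ind (fun m => c <= m)) => //.
  apply: leq_trans (cF y) _; apply/subset_leq_card/subsetP => A.
  by rewrite inE => /andP[].
by move=> a b ca cb; rewrite leq_min ca.
Qed.

(** The minimum is attained outside x |: S. A point of S lies in all the k-sets that
contain it together with x; and x lies in all members except S. *)
Lemma min_degree_HM n k (S : {set 'I_n}) (x : 'I_n) :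
  1 < k -> k.+1 < n -> #|S| = k -> x \notin S ->
  min_degree (HM k S x) = 'C(n - 2, k - 2) - 'C(n - k - 2, k - 2).
Proof.
move=> k1 kn cS xS.
have HE : HM k S x = S |: star_meeting k x S.
  by apply/setP => A; rewrite !inE.
have degE := fun y => @degree_star_meeting 'I_n k x y S k1 cS xS.
rewrite card_ord in degE.
have [y yY] : exists y, y \in ~: (x |: S).
  by apply/card_gt0P; rewrite cardsCs setCK cardsU1 xS cS card_ord; lia.
move: yY; rewrite !inE negb_or => /andP[yx yS].
have degY z : z != x -> z \notin S ->
    degree (HM k S x) z = 'C(n - 2, k - 2) - 'C(n - k - 2, k - 2).
  move=> zx zS; rewrite -(degE z) // 1?eq_sym // /degree HE; congr #|pred_of_set _|.
  apply/setP => A; rewrite !inE.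
  by case: eqP => // ->; rewrite (negPf zS) !andbF.
apply/eqP; rewrite eqn_leq -{1}(degY y) // min_degree_le /=.
apply: (min_degree_ge y) => z; case: (eqVneq z x) => [->|zx].
  rewrite -(degE y) // 1?eq_sym //; apply/subset_leq_card/subsetP => A.
  by rewrite HE !inE => /andP[/and3P[-> -> ->] _]; rewrite orbT.
case: (boolP (z \in S)) => zS; last by rewrite degY.
apply: leq_trans (leq_subr _ _) _.
have <- : #|[set A : {set 'I_n} | [&& [set x; z] \subset A, A \subset setT & #|A| == k]]|
    = 'C(n - 2, k - 2).
  by rewrite card_between ?subsetT ?cards2 1?eq_sym ?zx // cardsT card_ord.
apply/subset_leq_card/subsetP => A; rewrite HE !inE subUset !sub1set.
case/and3P => /andP[xA zA] _ ->; rewrite xA zA andbT /=; apply/orP; right.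
by apply/set0Pn; exists z; rewrite inE zA.
Qed.

Theorem theorem1 (k n : nat) (hk : 4 <= k)
  (hn : (if (k == 4) || (k == 5) then 30 else 4) * k ^ 2 <= n)
  (F : {set {set 'I_n}}) (hF : F \subset ksubsets n k)
  (hint : intersecting F) (hnontriv : ~ trivial_family k F)
  (S : {set 'I_n}) (x : 'I_n) (hS : #|S| = k) (hx : x \notin S) :
  min_degree F <= min_degree (HM k S x) /\
  min_degree (HM k S x) = 'C(n - 2, k - 2) - 'C(n - k - 2, k - 2).
Proof.
have kn : 4 * (k * k) <= n.
  by move: hn; rewrite expnS expn1; case: ifP => _; lia.
have kn' : k + k <= n by nia.
have E := @min_degree_HM n k S x _ _ hS hx.
rewrite E; [|lia..]; split=> //.
have unif A : A \in F -> #|A| = k.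
  by move/(subsetP hF); rewrite inE => /eqP.
have ncov y : exists2 A, A \in F & y \notin A.
  case: (boolP [exists A in F, y \notin A]) => [/exists_inP[A]|all_y]; first by exists A.
  case: hnontriv; exists y; apply/subsetP => A AF; rewrite inE (subsetP hF) //=.
  by apply: contraNT all_y => yA; apply/exists_inP; exists A.
rewrite leqNgt; apply/negP => big.
have div y := @diversity_lower_bound 'I_n F k y _ _ unif hint (ncov y) _.
rewrite card_ord in div.
have {}div y : (k - 2) * 'C(n - 2 * k - 1, k - 2) + 2 <= #|[set A in F | y \notin A]|.
  by apply: div; [lia | lia | move=> z; apply: leq_trans big (min_degree_le F z)].
have [r rk [leL leF]] : exists2 r, 0 < r <= k &
    'C(n - 2 - r, k - r) + 'C(n - 3, k - 2)
      <= (k - 2) * 'C(n - 2 * k - 1, k - 2) + 2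
    /\ k * (k * (r * 'C(n - 3, k - 3))) <= (k - 2) * 'C(n - 2 * k - 1, k - 2).
  move: hn; case: ifP => k45 hn.
    by exists 3; [lia | apply: threshold_45].
  by exists 2; [lia | apply: threshold_ge6; lia].
have cod := @codegree_bound 'I_n F k r _ unif hint _ rk _ div.
rewrite card_ord in cod.
have sub : [set A in F | x \notin A] \subset F.
  by apply/subsetP => A; rewrite inE => /andP[].
have leFF := leq_trans (card_le_codegree unif hint ncov (cod (ltnW hk) kn' leL)) leF.
have := leq_trans (leq_trans (div x) (subset_leq_card sub)) leFF.
by rewrite -[leqRHS]addn0 leq_add2l.
Qed.
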